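(* Let $X_1,\dots,X_n$ be independent and identically distributed random variables with distribution function $F$ and order statistics $X_{1:n}\le\cdots\le X_{n:n}$. Let $1\le r<n$. The random variables $Y_1^{(r,t)}=(X_1\mid X_{r:n}\le t)$, $Y_2^{(r,t)}=(X_2\mid X_{r:n}\le t),\dots,Y_n^{(r,t)}=(X_n\mid X_{r:n}\le t)$ are dependent.
   Context: $F(x)=P\{X_1\le x\}$; $X_{r:n}$ is the $r$th smallest value among $X_1,\dots,X_n$. The conditional random variables $(X_1\mid A),\dots,(X_n\mid A)$, for an event $A$ with $P(A)>0$, are random variables whose joint law is the conditional law of $(X_1,\dots,X_n)$ given $A$, i.e. with joint distribution function $P\{X_1\le x_1,\dots,X_n\le x_n\mid A\}$. Dependent means not independent.
   Formalization: The condition F(t) < 1 is added: if F(t) = 1, the event X_{r:n} ≤ t has probability 1, so the Y_i have the joint law of the independent X_i and are independent, and the claim fails. *)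

(* Defs.v *)
From HB Require Import structures.
From mathcomp Require Import all_boot all_order all_algebra.
From mathcomp Require Import all_classical all_reals all_analysis.

Set Implicit Arguments.
Unset Strict Implicit.
Unset Printing Implicit Defensive.

Import Order.TTheory GRing.Theory Num.Theory.
Import numFieldNormedType.Exports.

Local Open Scope classical_set_scope.
Local Open Scope ring_scope.

(* Joint independence of the whole family (not merely pairwise): the product
   rule holds for every subfamily J and all Borel sets. *)
Definition mutually_independent (R : realType) (d : measure_display)
    (T : measurableType d) (P : probability T R) (I : finType)
    (X : I -> {RV P >-> R}) : Prop :=
  forall (J : {set I}) (B : I -> set R),
    (forall i, measurable (B i)) ->
    P [set w | forall i, i \in J -> B i (X i w)] =
    (\prod_(i in J) P (X i @^-1` B i))%E.

Definition identically_distributed (R : realType) (d : measure_display)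
    (T : measurableType d) (P : probability T R) (I : finType)
    (X : I -> {RV P >-> R}) : Prop :=
  forall (i j : I) (B : set R), measurable B ->
    distribution P (X i) B = distribution P (X j) B.

(* [order_stat X r w] is the r-th smallest value for 1 <= r <= n; ranks start
   at 1, whereas [nth] counts from 0. *)
Definition order_stat (R : realType) (T : Type) (n : nat)
    (X : 'I_n -> T -> R) (r : nat) (w : T) : R :=
  nth 0 (sort <=%R [seq X i w | i <- enum 'I_n]) r.-1.

(* P(E | A), meaningful when P(A) > 0. *)
Definition cond_prob (R : realType) (d : measure_display)
    (T : measurableType d) (P : probability T R) (A E : set T) : R :=
  fine (P (E `&` A)) / fine (P A).

(* The family Y, possibly living on another probability space, is a version of
   ((X_i | A))_i: its joint distribution function is the conditional joint
   distribution function of X given A. *)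
Definition conditional_RVs (R : realType)
    (d : measure_display) (T : measurableType d) (P : probability T R)
    (d' : measure_display) (T' : measurableType d') (Q : probability T' R)
    (n : nat) (X : 'I_n -> {RV P >-> R}) (A : set T)
    (Y : 'I_n -> {RV Q >-> R}) : Prop :=
  forall x : 'I_n -> R,
    Q [set w | forall i, Y i w <= x i] =
    (cond_prob P A [set w | forall i, X i w <= x i])%:E.

(* Main.v *)
Require Import Defs.
From HB Require Import structures.
From mathcomp Require Import all_boot all_order all_algebra.
From mathcomp Require Import all_classical all_reals all_analysis.
Set Implicit Arguments.
Unset Strict Implicit.
Unset Printing Implicit Defensive.
Import Order.TTheory GRing.Theory Num.Theory.
Import numFieldNormedType.Exports.
Local Open Scope classical_set_scope.
Local Open Scope ring_scope.

(** The conditioning event A says that at least r of the X_i are at most t.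
It always occurs when at most one of the X_i exceeds t, because r < n, and it
never occurs when all of them do, because r >= 1.  In particular p = F t is
positive: otherwise all X_i would almost surely exceed t and A would be null.

Suppose the Y_i are independent.  Since p < 1 and F tends to 1 at infinity,
there is M with b = F M > p.  Compare the joint distribution functions
of X and Y at points y all of whose coordinates are t or M.  As long as at most
one coordinate is M, the box {X_i <= y_i for all i} lies in A, so that
P(Y <= y) = P(X <= y) / P(A).  Both sides factor over i; dividing the value
with M in place i by the value with t everywhere gives
P(Y_i <= M) / P(Y_i <= t) = b / p for every i.  Multiplying these ratios
back extends the formula to the corner where every coordinate is M
([prod_from_corners]), that is, P(X_i <= M for all i, A) is equal to
P(X_i <= M for all i).  Yet the event that all X_i lie in ]t, M] has
probability (b - p)^n > 0, is contained in the latter box and misses A, a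
contradiction.

Only these finitely many values of the joint distribution function of Y are
compared, so no limit has to be taken to recover the marginal laws of Y. *)

(** * The event that an order statistic is at most t *)

(** Stated as a count, the event no longer depends on how the sample is
sorted; this is what makes it a finite union of boxes. *)
Lemma order_stat_le (R : realType) (T : Type) (n : nat) (X : 'I_n -> T -> R)
    (r : nat) (w : T) (t : R) : (0 < r <= n)%N ->
  (order_stat X r w <= t) = (r <= #|[set i | (X i w <= t)%R]%SET|)%N.
Proof.
case: r => // r /= r_lt_n; rewrite /order_stat /=.
set s := sort _ _.
have s_sorted : sorted <=%O s by exact: sort_le_sorted.
have size_s : size s = n by rewrite size_sort size_map size_enum_ord.
have count_s : count (<= t)%O s = #|[set i | (X i w <= t)%R]%SET|.
  rewrite count_sort count_map cardE enumT /enum_mem size_filter.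
  by apply: eq_count => i; rewrite /= inE.
rewrite -count_s; case: ltnP => [|count_le_r]; first exact: nth_count_le.
by apply/negbTE; rewrite -ltNge nth_count_gt// count_le_r size_s.
Qed.

(** At least r of the X_i are at most t exactly when all X_i with i in S are,
for some set S of at least r indices: a finite union of finite intersections.
Measurability is what allows the mass of a box to be split into the parts inside
and outside this event. *)
Lemma measurable_order_stat_le (R : realType) (d : measure_display)
    (T : measurableType d) (P : probability T R) (n : nat)
    (X : 'I_n -> {RV P >-> R}) (r : nat) (t : R) : (0 < r <= n)%N ->
  measurable [set w | order_stat X r w <= t].
Proof.
move=> r_bounds.
have -> : [set w | order_stat X r w <= t] =
    \bigcup_(S in [set S : {set 'I_n} | (r <= #|S|)%N])
      \bigcap_(i in [set i | i \in S]) (X i @^-1` `]-oo, t]).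
  apply/seteqP; split=> w /=; rewrite order_stat_le//.
    move=> r_le; exists [set i | (X i w <= t)%R]%SET => //= i /=.
    by rewrite inE in_itv.
  case=> S /= r_le S_le; apply: (leq_trans r_le); apply/subset_leq_card.
  by apply/fintype.subsetP => i iS; have := S_le i iS; rewrite /= in_itv /= inE.
apply: fin_bigcup_measurable => // S _; apply: fin_bigcap_measurable => // i _.
exact: measurable_funPTI.
Qed.

(** * Boxes under independence *)

Lemma box_itv (R : realType) (T I : Type) (X : I -> T -> R) (y : I -> R) :
  [set w | forall i, X i w <= y i] =
  [set w | forall i, `]-oo, y i]%classic (X i w)].
Proof. by apply/seteqP; split=> w /= + i => /(_ i); rewrite /= in_itv. Qed.

Lemma measurable_box (R : realType) (d : measure_display)
    (T : measurableType d) (P : probability T R) (I : finType)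
    (X : I -> {RV P >-> R}) (B : I -> set R) : (forall i, measurable (B i)) ->
  measurable [set w | forall i, B i (X i w)].
Proof.
move=> mB; rewrite (_ : mkset _ = \bigcap_(i in setT) (X i @^-1` B i)).
  by apply: fin_bigcap_measurable => // i _; exact: measurable_funPTI.
by apply/seteqP; split=> w /= + i => /(_ i) //; apply.
Qed.

Lemma indep_box (R : realType) (d : measure_display) (T : measurableType d)
    (P : probability T R) (I : finType) (X : I -> {RV P >-> R})
    (B : I -> set R) : mutually_independent X -> (forall i, measurable (B i)) ->
  fine (P [set w | forall i, B i (X i w)]) =
  \prod_i fine (P (X i @^-1` B i)).
Proof.
move=> X_indep mB; have := X_indep [set: I]%SET B mB.
have -> : [set w | forall i, i \in [set: I]%SET -> B i (X i w)] =
          [set w | forall i, B i (X i w)].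
  by apply/seteqP; split=> w /= Bw i *; apply: Bw; rewrite inE.
move=> ->; rewrite -[RHS]/(fine (_)%:E) -prodEFin; congr fine.
apply: eq_big => [i|i _]; first by rewrite inE.
by rewrite fineK// fin_num_measure//; exact: measurable_funPTI.
Qed.

Lemma prob_preimage_itv (R : realType) (d : measure_display)
    (T : measurableType d) (P : probability T R) (X : {RV P >-> R})
    (s t : R) : s <= t ->
  P (X @^-1` `]s, t]) = (cdf X t - cdf X s)%E.
Proof.
move=> st.
have mX x : measurable (X @^-1` `]-oo, x]) by exact: measurable_funPTI.
have -> : X @^-1` `]s, t] = X @^-1` `]-oo, t] `\` X @^-1` `]-oo, s].
  apply/seteqP; split=> w /=; rewrite !in_itv /=.
    by move=> /andP[sX Xt]; split=> //; apply/negP; rewrite -ltNge.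
  by case=> -> /negP; rewrite -ltNge => ->.
have le_st : X @^-1` `]-oo, s] `<=` X @^-1` `]-oo, t].
  by move=> w /=; rewrite !in_itv /= => /le_trans; apply.
transitivity (P (X @^-1` `]-oo, t]) - P (X @^-1` `]-oo, s]))%E; last by [].
rewrite -[in RHS](setIidr le_st).
by apply: measureD; rewrite ?ltey_eq ?fin_num_measure//; exact: mX.
Qed.

Lemma cdf_exceeds (R : realType) (d : measure_display)
    (T : measurableType d) (P : probability T R) (X : {RV P >-> R}) (c : R) :
  c < 1 -> exists M, (c%:E < cdf X M)%E.
Proof.
move=> c1; have /= := @cvg_cdfy1 _ _ _ P X.
have : nbhs (1%E : \bar R) [set y | (c%:E < y)%E].
  apply: open_nbhs_nbhs; split; first exact: open_ereal_gt_ereal.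
  by rewrite /= lte_fin.
move=> nb /(_ _ nb) /= [M [_ MP]]; exists (M + 1); apply: MP.
by rewrite ltrDl.
Qed.

(** * Extrapolation of a product formula to the opposite corner *)

(** Both products factor over the coordinates, so changing coordinate i from u
to v multiplies the left side by v i / u i and the right side by v' i / u' i.
Agreement at the corners with at most one changed coordinate therefore
equates these ratios, and multiplying all of them together gives the corner
where every coordinate is changed. *)
Lemma prod_from_corners (K : fieldType) (I : finType) (k : K)
    (u v u' v' : I -> K) : k != 0 -> \prod_i u' i != 0 ->
  \prod_i u i = k * \prod_i u' i ->
  (forall i, \prod_j (if j == i then v j else u j) =
             k * \prod_j (if j == i then v' j else u' j)) ->
  \prod_i v i = k * \prod_i v' i.
Proof.
move=> k0 u'0 uE vE.
have u0 : \prod_i u i != 0 by rewrite uE mulf_neq0.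
have ui0 i : u i != 0 by move/prodf_neq0: u0; exact.
have u'i0 i : u' i != 0 by move/prodf_neq0: u'0; exact.
have corner (f g : I -> K) i : g i != 0 ->
    \prod_j (if j == i then f j else g j) = f i / g i * \prod_j g j.
  move=> gi0; rewrite (bigD1 i)//= (bigD1 i (F := g))//= eqxx.
  rewrite mulrA divfK//; congr (_ * _).
  by apply: eq_bigr => j /negbTE ->.
have ratio i : v i / u i = v' i / u' i.
  apply: (mulIf u0); rewrite -corner// vE corner// uE.
  by rewrite mulrCA.
have -> : \prod_i v i = \prod_i (u i * (v' i / u' i)).
  by apply: eq_bigr => i _; rewrite -ratio mulrCA divff// mulr1.
by rewrite big_split /= prodf_div uE -mulrA [_ * (_ / _)]mulrC divfK.
Qed.

Theorem proposition4 (R : realType)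
    (d : measure_display) (T : measurableType d) (P : probability T R)
    (n : nat) (X : 'I_n -> {RV P >-> R}) (F : R -> R)
    (X_indep : mutually_independent X)
    (X_ident : identically_distributed X)
    (X_cdf : forall (i : 'I_n) (x : R), cdf (X i) x = (F x)%:E)
    (r : nat) (r_ge1 : (1 <= r)%N) (r_ltn : (r < n)%N)
    (t : R)
    (A_pos : (0 < P [set w | (order_stat X r w <= t)%R])%E)
    (Ft_lt1 : F t < 1)
    (d' : measure_display) (T' : measurableType d') (Q : probability T' R)
    (Y : 'I_n -> {RV Q >-> R})
    (Y_cond : conditional_RVs X [set w | order_stat X r w <= t] Y) :
  ~ mutually_independent Y.
Proof.
move=> Y_indep; have n_gt0 : (0 < n)%N by exact: leq_trans r_ltn.
set A := [set w | order_stat X r w <= t] in A_pos Y_cond.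
have AE w : A w = (r <= #|[set i | (X i w <= t)%R]%SET|)%N :> Prop.
  by rewrite /A /= order_stat_le// r_ge1 ltnW.
have mA : measurable A by apply: measurable_order_stat_le; rewrite r_ge1 ltnW.
have mX i x : measurable (X i @^-1` `]-oo, x]) by exact: measurable_funPTI.
pose a := fine (P A).
have a0 : 0 < a by rewrite fine_gt0// A_pos ltey_eq fin_num_measure.
have FE i x : P (X i @^-1` `]-oo, x]) = (F x)%:E by rewrite -(X_cdf i).
have missA w : (forall i, t < X i w) -> ~ A w.
  move=> X_gt; rewrite AE; suff -> : [set i | (X i w <= t)%R]%SET = finset.set0.
    by rewrite cards0 leqNgt r_ge1.
  by apply/setP => i; rewrite !inE leNgt X_gt.
have probX y : fine (P [set w | forall i, X i w <= y i]) = \prod_i F (y i).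
  rewrite box_itv (indep_box (B := fun i => `]-oo, y i]%classic))//.
  by apply: eq_bigr => i _; rewrite FE.
pose G i x := fine (Q (Y i @^-1` `]-oo, x])).
have probY y : \prod_i G i (y i) =
    fine (P ([set w | forall i, X i w <= y i] `&` A)) / a.
  rewrite -(indep_box (B := fun i => `]-oo, y i]%classic)) //.
  have := Y_cond y; rewrite /cond_prob => /(congr1 fine) /= <-.
  by rewrite -box_itv.
have F_ge0 x : 0 <= F x by rewrite -lee_fin -(FE (Ordinal n_gt0)) measure_ge0.
have Ft0 : 0 < F t.
  (* If F t = 0, the event C that all X_i exceed t is almost sure. *)
  rewrite lt_neqAle F_ge0 andbT eq_sym; apply/eqP => Ft0.
  pose C := [set w | forall i, (~` `]-oo, t]%classic) (X i w)].
  have mC : measurable C.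
    by apply: (measurable_box X (B := fun=> _)) => i; exact: measurableC.
  have PC : P C = 1%E.
    rewrite -[LHS]fineK ?fin_num_measure//.
    rewrite (indep_box (B := fun=> ~` `]-oo, t]%classic))//; last first.
      by move=> i; exact: measurableC.
    rewrite big1 => [//|i _]; rewrite preimage_setC probability_setC.
      by rewrite FE Ft0 sube0.
    exact: mX.
  have : (P A <= P (~` C))%E.
    rewrite le_measure ?inE//; first exact: measurableC.
    move=> w /= Aw Cw; apply: (missA w) => // i.
    by have := Cw i; rewrite /= in_itv /= => /negP; rewrite -ltNge.
  by rewrite probability_setC// PC subee// leNgt A_pos.
have [M FM] : exists M, F t < F M.
  have [M] := cdf_exceeds (X (Ordinal n_gt0)) Ft_lt1.
  by rewrite X_cdf lte_fin; exists M.
have tM : t < M.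
  rewrite ltNge; apply/negP => Mt; move: FM; rewrite ltNge => /negP; apply.
  by rewrite -lee_fin -!(X_cdf (Ordinal n_gt0)); exact: cdf_nondecreasing.
(* With at most one coordinate of y different from t, at least n - 1 >= r of the
   X_i are at most t on the box, which is thus contained in A. *)
have box_in_A y i : (forall j, j != i -> y j = t) ->
    \prod_j G j (y j) = a^-1 * \prod_j F (y j).
  move=> yt; rewrite probY -probX mulrC; congr (_ * fine (P _)).
  apply/setIidPl => w /= Xw; rewrite AE; apply: (@leq_trans #|[set~ i]%SET|).
    by rewrite cardsC1 card_ord -ltnS prednK.
  apply/subset_leq_card/fintype.subsetP => j; rewrite !inE => ji.
  by rewrite -(yt j ji).
have GM : \prod_i G i M = a^-1 * \prod_(i < n) F M.
  apply: (prod_from_corners (u := fun i => G i t) (u' := fun=> F t)).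
  - by rewrite invr_eq0 gt_eqF.
  - by apply/prodf_neq0 => i _; rewrite gt_eqF.
  - (* The constant point t differs from t nowhere, so any index will do. *)
    exact: (box_in_A (fun=> t) (Ordinal n_gt0)).
  - move=> i; pose y j := if j == i then M else t.
    have yt j : j != i -> y j = t by rewrite /y => /negbTE ->.
    have := box_in_A y i yt; rewrite /y.
    under eq_bigr do rewrite (fun_if (G _)).
    by under [in RHS]eq_bigr do rewrite (fun_if F).
(* Up to a null set the box B is contained in A, although its subset D, where
   all X_i exceed t, misses A and has positive probability. *)
pose B := [set w | forall i, X i w <= M].
have mB : measurable B.
  rewrite /B box_itv.
  by apply: (measurable_box X (B := fun=> `]-oo, M]%classic)).
have PBA : fine (P (B `&` A)) = fine (P B).
  apply: (mulIf (x := a^-1)); first by rewrite invr_eq0 gt_eqF.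
  by rewrite -(probY (fun=> M)) GM probX mulrC.
have PBmA : P (B `\` A) = 0%E.
  have mBA : measurable (B `&` A) by exact: measurableI.
  have -> : P (B `\` A) = (P B - P (B `&` A))%E.
    by apply: measureD => //; rewrite ltey_eq fin_num_measure.
  rewrite -[P (B `&` A)]fineK ?fin_num_measure// PBA fineK ?fin_num_measure//.
  by rewrite subee// fin_num_measure.
pose D := [set w | forall i, `]t, M]%classic (X i w)].
have mD : measurable D.
  by apply: (measurable_box X (B := fun=> `]t, M]%classic)).
have PD : 0 < fine (P D).
  rewrite (indep_box (B := fun=> `]t, M]%classic))//.
  apply: prodr_gt0 => i _; rewrite prob_preimage_itv ?(ltW tM)// !X_cdf.
  by rewrite subr_gt0.
have : (P D <= P (B `\` A))%E.
  rewrite le_measure ?inE//; first exact: measurableD.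
  move=> w Dw; have {}Dw i : t < X i w <= M by have := Dw i; rewrite /= in_itv.
  split; first by move=> i; case/andP: (Dw i).
  by apply: missA => i; case/andP: (Dw i).
rewrite PBmA => /fine_le; rewrite ?fin_num_measure//= => /(_ isT isT).
by rewrite leNgt PD.
Qed.
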